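(* Let $p\in\mathbb{R}$. The inequality $$B(a,b)<M_{p}(a,b)$$ holds for all $a,b>0$ with $a\neq b$ if and only if $p\geq 4/3$. Moreover, if $p\geq 4/3$, then the inequality $$B(a,b)>\lambda_{p}M_{p}(a,b)$$ holds for all $a,b>0$ with $a\neq b$, with the best possible parameter $\lambda_{p}=e^{\pi/4-1}2^{1/p-1/2}$ (i.e. $\lambda_p$ cannot be replaced by any larger constant).
   Context: For $a,b>0$ with $a\neq b$ and $r\in\mathbb{R}$, the $r$th power mean is $M_{r}(a,b)=\left(\frac{a^{r}+b^{r}}{2}\right)^{1/r}$ for $r\neq 0$ and $M_{0}(a,b)=\sqrt{ab}$. Let $A(a,b)=\frac{a+b}{2}$ (arithmetic mean), $Q(a,b)=\sqrt{\frac{a^{2}+b^{2}}{2}}$ (quadratic mean), $T(a,b)=\frac{a-b}{2\arctan\left(\frac{a-b}{a+b}\right)}$ (second Seiffert mean), and $B(a,b)=Q(a,b)e^{A(a,b)/T(a,b)-1}$ (Sándor-Yang mean). *)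

(* Defs.v *)
From Stdlib Require Import Reals.
Open Scope R_scope.

(** All the means below are meant for [a, b > 0] with [a <> b]. *)

(** [Rpower x y] is the real power x^y for [x > 0]. *)
Definition power_mean (r a b : R) : R :=
  if Req_EM_T r 0 then sqrt (a * b)
  else Rpower ((Rpower a r + Rpower b r) / 2) (1 / r).

Definition arithmetic_mean (a b : R) : R := (a + b) / 2.

Definition quadratic_mean (a b : R) : R := sqrt ((a ^ 2 + b ^ 2) / 2).

(** The denominator vanishes only for [a = b], which is excluded. *)
Definition second_seiffert_mean (a b : R) : R :=
  (a - b) / (2 * atan ((a - b) / (a + b))).

Definition sandor_yang_mean (a b : R) : R :=
  quadratic_mean a b *
  exp (arithmetic_mean a b / second_seiffert_mean a b - 1).

Definition lambda (p : R) : R :=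
  exp (PI / 4 - 1) * Rpower 2 (1 / p - 1 / 2).

(* Main.v *)
Require Import Defs.
From Stdlib Require Import Reals Lra.
From Coquelicot Require Import Coquelicot.
Open Scope R_scope.

(** Both means are symmetric and homogeneous of degree 1, so everything is
    decided on the pairs [(1 + v, 1 - v)] with [0 < v < 1]. There the arguments
    become [B = sqrt (1 + v^2) * exp (atan v / v - 1)] and
    [M_p = (((1 + v)^p + (1 - v)^p) / 2)^(1/p)], and the theorem is a statement
    about the function [D_p(v) = ln M_p - ln B] ([log_gap]): the upper bound
    says [D_p > 0], and a lower bound with constant [c] says [D_p < - ln c].

    For [p >= 4/3] the function [D_p] is increasing on [(0, 1)]
    ([log_gap_increasing]); it tends to [0] at [0+] ([filterlim_log_gap_0]) and
    to [- ln (lambda p)] at [1-] ([filterlim_log_gap_1]). These two limits are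
    strict bounds, and the second one cannot be improved.

    Monotonicity comes from [D_p'(v) = G_p(v) - (v - atan v) / v^2], where
    [G_p] is the logarithmic derivative of [M_p] ([power_mean_slope]). Since
    [G_p] increases with [p] ([power_mean_slope_le]), only [p = 4/3] has to be
    examined. For that exponent the substitution
    [v = (1 - t^3) / (1 + t^3)], i.e. [t = ((1 - v) / (1 + v))^(1/3)], makes
    [v - v^2 G_p(v)] rational in [t], and the claim becomes a lower bound for
    [atan v] by a rational function of [t] ([atan_rational_bound]), which is
    proved by differentiating.

    For [p < 4/3], [G_p(v)] is [(p - 1) v] to first order at [0], while
    [(v - atan v) / v^2] is [v / 3]; hence [D_p] decreases from its limit [0]
    and is negative near [0], so that the upper bound fails
    ([log_gap_negative_near_0]). *)

(** * Monotone functions and one-sided limits *)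

Lemma increasing_of_derive_pos (f df : R -> R) (a b : R) :
  (forall x, a < x < b -> is_derive f x (df x)) ->
  (forall x, a < x < b -> 0 < df x) ->
  forall x y, a < x -> x < y -> y < b -> f x < f y.
Proof.
intros Hd Hpos x y Hax Hxy Hyb.
apply (incr_function f a b df); try easy.
- intros z Hza Hzb; now apply Hd.
- intros z Hza Hzb; now apply Hpos.
Qed.

Lemma eventually_at_right (a c : R) : a < c -> at_right a (fun y => a < y < c).
Proof.
intros Hac; assert (Hpos : 0 < c - a) by lra.
exists (mkposreal _ Hpos); intros y Hy Hay.
apply Rabs_lt_between in Hy; unfold minus, plus, opp in Hy; simpl in Hy; lra.
Qed.

Lemma eventually_at_left (b c : R) : c < b -> at_left b (fun y => c < y < b).
Proof.
intros Hcb; assert (Hpos : 0 < b - c) by lra.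
exists (mkposreal _ Hpos); intros y Hy Hyb.
apply Rabs_lt_between in Hy; unfold minus, plus, opp in Hy; simpl in Hy; lra.
Qed.

(** Strictness survives the passage to the limit because the midpoint of [a]
    and [x] already separates [f x] from the values of [f] near [a]. *)
Lemma right_limit_lt_of_increasing (f : R -> R) (a b l : R) :
  (forall x y, a < x -> x < y -> y < b -> f x < f y) ->
  filterlim f (at_right a) (locally l) ->
  forall x, a < x < b -> l < f x.
Proof.
intros Hincr Hlim x Hx.
apply Rle_lt_trans with (f ((a + x) / 2)); [|apply Hincr; lra].
apply (filterlim_le (F := at_right a) f (fun _ => f ((a + x) / 2)) l
         (f ((a + x) / 2))).
- apply (filter_imp (fun y => a < y < (a + x) / 2)).
  + intros y Hy; apply Rlt_le, Hincr; lra.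
  + apply eventually_at_right; lra.
- exact Hlim.
- apply filterlim_const.
Qed.

Lemma lt_left_limit_of_increasing (f : R -> R) (a b l : R) :
  (forall x y, a < x -> x < y -> y < b -> f x < f y) ->
  filterlim f (at_left b) (locally l) ->
  forall x, a < x < b -> f x < l.
Proof.
intros Hincr Hlim x Hx.
apply Rlt_le_trans with (f ((x + b) / 2)); [apply Hincr; lra|].
apply (filterlim_le (F := at_left b) (fun _ => f ((x + b) / 2)) f
         (f ((x + b) / 2)) l).
- apply (filter_imp (fun y => (x + b) / 2 < y < b)).
  + intros y Hy; apply Rlt_le, Hincr; lra.
  + apply eventually_at_left; lra.
- apply filterlim_const.
- exact Hlim.
Qed.

Lemma filterlim_Rminus (F : (R -> Prop) -> Prop) {FF : Filter F}
    (f g : R -> R) (a b : R) :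
  filterlim f F (locally a) -> filterlim g F (locally b) ->
  filterlim (fun x => f x - g x) F (locally (a - b)).
Proof.
intros Hf Hg.
apply (filterlim_comp_2 (G := locally a) (H := locally (- b))
  f (fun x => - g x) Rplus Hf).
- apply (filterlim_comp _ _ _ g Ropp _ (locally b) _ Hg), (filterlim_opp b).
- apply (filterlim_plus a (- b)).
Qed.

Lemma filterlim_within_of_ex_derive (D : R -> Prop) (f : R -> R) (x : R) :
  ex_derive f x -> filterlim f (within D (locally x)) (locally (f x)).
Proof.
intros Hf; apply (filterlim_filter_le_1 (F := locally x)).
- apply filter_le_within.
- now apply (ex_derive_continuous f).
Qed.

Lemma Rpower_pos (x y : R) : 0 < Rpower x y.
Proof. apply exp_pos. Qed.

Lemma Rpower_step (x y : R) : 0 < x -> Rpower x y = x * Rpower x (y - 1).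
Proof.
intros Hx.
replace y with (1 + (y - 1)) at 1 by ring.
now rewrite Rpower_plus, Rpower_1.
Qed.

Lemma filterlim_Rpower_0 (p : R) :
  0 < p -> filterlim (fun x => Rpower x p) (at_right 0) (locally 0).
Proof.
intros Hp; apply filterlim_locally; intros eps.
apply (filter_imp (fun x => 0 < x < Rpower eps (/ p)));
  [|apply eventually_at_right, Rpower_pos].
intros x Hx.
apply Rabs_lt_between; unfold minus, plus, opp; simpl.
assert (H : Rpower x p < eps).
{ replace (pos eps) with (Rpower (Rpower eps (/ p)) p).
  - apply Rlt_Rpower_l; lra.
  - rewrite Rpower_mult, Rinv_l, Rpower_1; [easy|apply cond_pos|lra]. }
generalize (Rpower_pos x p); lra.
Qed.

(** * Reduction to the pairs (1 + v, 1 - v) *)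

(** The logarithm of [sandor_yang_mean (1 + v) (1 - v)]; here
    [atan v / v] is the quotient of the arithmetic and Seiffert means. *)
Definition log_sandor_yang (v : R) : R :=
  / 2 * ln (1 + v ^ 2) + atan v / v - 1.

(** The logarithm of [power_mean p (1 + v) (1 - v)]. *)
Definition log_power_mean (p v : R) : R :=
  if Req_EM_T p 0 then / 2 * (ln (1 + v) + ln (1 - v))
  else 1 / p * ln ((Rpower (1 + v) p + Rpower (1 - v) p) / 2).

Definition log_gap (p v : R) : R := log_power_mean p v - log_sandor_yang v.

Lemma sandor_yang_mean_sym (a b : R) :
  sandor_yang_mean a b = sandor_yang_mean b a.
Proof.
unfold sandor_yang_mean, quadratic_mean, arithmetic_mean, second_seiffert_mean.
rewrite (Rplus_comm (a ^ 2)), (Rplus_comm b a).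
replace ((b - a) / (a + b)) with (- ((a - b) / (a + b))) by (unfold Rdiv; ring).
rewrite atan_opp.
replace ((b - a) / (2 * - atan ((a - b) / (a + b))))
  with ((a - b) / (2 * atan ((a - b) / (a + b)))); [reflexivity|].
unfold Rdiv; replace (2 * - atan ((a - b) * / (a + b)))
  with (- (2 * atan ((a - b) * / (a + b)))) by ring.
rewrite Rinv_opp; ring.
Qed.

Lemma power_mean_sym (p a b : R) : power_mean p a b = power_mean p b a.
Proof.
unfold power_mean; destruct (Req_EM_T p 0).
- now rewrite Rmult_comm.
- now rewrite Rplus_comm.
Qed.

Lemma atan_pos (v : R) : 0 < v -> 0 < atan v.
Proof. intros Hv; rewrite <- atan_0; now apply atan_increasing. Qed.

Lemma sandor_yang_mean_exp (A v : R) : 0 < A -> 0 < v < 1 ->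
  sandor_yang_mean (A * (1 + v)) (A * (1 - v)) = A * exp (log_sandor_yang v).
Proof.
intros HA Hv.
unfold sandor_yang_mean, quadratic_mean, arithmetic_mean,
  second_seiffert_mean, log_sandor_yang.
assert (Hat := atan_pos v (proj1 Hv)).
replace ((A * (1 + v) - A * (1 - v)) / (A * (1 + v) + A * (1 - v)))
  with v by (field; lra).
replace ((A * (1 + v) + A * (1 - v)) / 2
  / ((A * (1 + v) - A * (1 - v)) / (2 * atan v))) with (atan v / v)
  by (field; repeat split; nra).
replace (((A * (1 + v)) ^ 2 + (A * (1 - v)) ^ 2) / 2)
  with (A ^ 2 * (1 + v ^ 2)) by field.
assert (Hv2 : 0 < 1 + v ^ 2) by nra.
assert (HA2 := pow2_ge_0 A).
rewrite sqrt_mult, sqrt_pow2 by lra.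
replace (/ 2 * ln (1 + v ^ 2) + atan v / v - 1)
  with (/ 2 * ln (1 + v ^ 2) + (atan v / v - 1)) by ring.
rewrite exp_plus.
change (exp (/ 2 * ln (1 + v ^ 2))) with (Rpower (1 + v ^ 2) (/ 2)).
rewrite Rpower_sqrt by lra; ring.
Qed.

Lemma power_mean_exp (p A v : R) : 0 < A -> 0 < v < 1 ->
  power_mean p (A * (1 + v)) (A * (1 - v)) = A * exp (log_power_mean p v).
Proof.
intros HA Hv; unfold power_mean, log_power_mean.
destruct (Req_EM_T p 0) as [_|Hp].
- replace (A * (1 + v) * (A * (1 - v))) with (A ^ 2 * ((1 + v) * (1 - v)))
    by ring.
  rewrite <- ln_mult by lra.
  change (exp (/ 2 * ln ((1 + v) * (1 - v))))
    with (Rpower ((1 + v) * (1 - v)) (/ 2)).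
  assert (HA2 := pow2_ge_0 A).
  assert (Hv2 : 0 < (1 + v) * (1 - v)) by nra.
  rewrite Rpower_sqrt, sqrt_mult, sqrt_pow2 by lra; ring.
- rewrite <- !Rpower_mult_distr by lra.
  generalize (Rpower_pos A p) (Rpower_pos (1 + v) p) (Rpower_pos (1 - v) p).
  intros H1 H2 H3.
  replace ((Rpower A p * Rpower (1 + v) p + Rpower A p * Rpower (1 - v) p) / 2)
    with (Rpower A p * ((Rpower (1 + v) p + Rpower (1 - v) p) / 2)) by field.
  rewrite <- Rpower_mult_distr by lra.
  rewrite Rpower_mult.
  replace (p * (1 / p)) with 1 by now field.
  now rewrite Rpower_1.
Qed.

(** For [b < a] the scale is [A = (a + b) / 2] and the parameter is
    [v = (a - b) / (a + b)]; symmetry covers [a < b]. *)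
Lemma forall_pairs_of_normalized (P : R -> R -> Prop) :
  (forall a b, P b a -> P a b) ->
  (forall A v, 0 < A -> 0 < v < 1 -> P (A * (1 + v)) (A * (1 - v))) ->
  forall a b, 0 < a -> 0 < b -> a <> b -> P a b.
Proof.
intros Hsym Hnorm.
assert (Hlt : forall a b, 0 < b -> b < a -> P a b).
{ intros a b Hb Hab.
  assert (Hv : 0 < (a - b) / (a + b) < 1).
  { split; [apply Rdiv_lt_0_compat; lra|].
    apply Rmult_lt_reg_r with (a + b); [lra|].
    unfold Rdiv; rewrite Rmult_assoc, Rinv_l; lra. }
  assert (H := Hnorm ((a + b) / 2) _ ltac:(lra) Hv).
  replace ((a + b) / 2 * (1 + (a - b) / (a + b))) with a in H by (field; lra).
  replace ((a + b) / 2 * (1 - (a - b) / (a + b))) with b in H by (field; lra).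
  exact H. }
intros a b Ha Hb Hab; destruct (Rlt_or_le b a) as [Hba|Hba].
- now apply Hlt.
- apply Hsym, Hlt; lra.
Qed.

Lemma upper_bound_iff_log_gap (p : R) :
  (forall a b, 0 < a -> 0 < b -> a <> b ->
     sandor_yang_mean a b < power_mean p a b) <->
  (forall v, 0 < v < 1 -> 0 < log_gap p v).
Proof.
assert (Hkey : forall A v, 0 < A -> 0 < v < 1 ->
  (sandor_yang_mean (A * (1 + v)) (A * (1 - v))
     < power_mean p (A * (1 + v)) (A * (1 - v)) <-> 0 < log_gap p v)).
{ intros A v HA Hv; rewrite power_mean_exp, sandor_yang_mean_exp by easy.
  unfold log_gap; split; intros H.
  - apply Rmult_lt_reg_l in H; [|easy]; apply exp_lt_inv in H; lra.
  - apply Rmult_lt_compat_l; [easy|]; apply exp_increasing; lra. }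
split; intros H.
- intros v Hv; apply (Hkey 1 v Rlt_0_1 Hv), H; lra.
- apply forall_pairs_of_normalized.
  + intros a b; now rewrite power_mean_sym, sandor_yang_mean_sym.
  + intros A v HA Hv; now apply Hkey, H.
Qed.

Lemma lower_bound_iff_log_gap (p c : R) : 0 < c ->
  (forall a b, 0 < a -> 0 < b -> a <> b ->
     c * power_mean p a b < sandor_yang_mean a b) <->
  (forall v, 0 < v < 1 -> log_gap p v < - ln c).
Proof.
intros Hc.
assert (Hkey : forall A v, 0 < A -> 0 < v < 1 ->
  (c * power_mean p (A * (1 + v)) (A * (1 - v))
     < sandor_yang_mean (A * (1 + v)) (A * (1 - v)) <->
   log_gap p v < - ln c)).
{ intros A v HA Hv; rewrite power_mean_exp, sandor_yang_mean_exp by easy.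
  unfold log_gap; rewrite <- (exp_ln c Hc) at 1.
  replace (exp (ln c) * (A * exp (log_power_mean p v)))
    with (A * exp (ln c + log_power_mean p v)) by (rewrite exp_plus; ring).
  split; intros H.
  - apply Rmult_lt_reg_l in H; [|easy]; apply exp_lt_inv in H; lra.
  - apply Rmult_lt_compat_l; [easy|]; apply exp_increasing; lra. }
split; intros H.
- intros v Hv; apply (Hkey 1 v Rlt_0_1 Hv), H; lra.
- apply forall_pairs_of_normalized.
  + intros a b; now rewrite power_mean_sym, sandor_yang_mean_sym.
  + intros A v HA Hv; now apply Hkey, H.
Qed.

(** * The derivative of the logarithmic gap *)

Definition power_mean_slope (p v : R) : R :=
  (Rpower (1 + v) (p - 1) - Rpower (1 - v) (p - 1))
  / (Rpower (1 + v) p + Rpower (1 - v) p).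

(** One formula serves all exponents: at [p = 0] it gives [- v / (1 - v^2)],
    the logarithmic derivative of [sqrt ((1 + v) (1 - v))]. *)
Lemma is_derive_log_power_mean (p v : R) : 0 < v < 1 ->
  is_derive (log_power_mean p) v (power_mean_slope p v).
Proof.
intros Hv; unfold log_power_mean, power_mean_slope.
assert (H1 := Rpower_pos (1 + v) (p - 1)).
assert (H2 := Rpower_pos (1 - v) (p - 1)).
assert (H3 : 0 < (1 + v) * Rpower (1 + v) (p - 1)
               + (1 - v) * Rpower (1 - v) (p - 1)) by nra.
rewrite !(Rpower_step _ p) by lra.
destruct (Req_EM_T p 0) as [Hp|Hp].
- auto_derive; [lra|].
  subst p; replace (0 - 1) with (- (1)) by ring.
  rewrite !Rpower_Ropp, !Rpower_1 by lra; field; lra.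
- apply is_derive_ext_loc with
    (fun x => 1 / p * ln ((exp (p * ln (1 + x)) + exp (p * ln (1 - x))) / 2)).
  { apply filter_forall; reflexivity. }
  assert (E1 : exp (p * ln (1 + v)) = (1 + v) * Rpower (1 + v) (p - 1))
    by (apply Rpower_step; lra).
  assert (E2 : exp (p * ln (1 - v)) = (1 - v) * Rpower (1 - v) (p - 1))
    by (apply Rpower_step; lra).
  auto_derive.
  + change (1 + - v) with (1 - v); rewrite E1, E2; repeat split; lra.
  + change (1 + - v) with (1 - v); rewrite E1, E2; field; repeat split; lra.
Qed.

Lemma is_derive_log_sandor_yang (v : R) : 0 < v ->
  is_derive log_sandor_yang v ((v - atan v) / v ^ 2).
Proof.
intros Hv; unfold log_sandor_yang.
assert (Hv2 : 0 < 1 + v ^ 2) by nra.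
auto_derive; [repeat split; nra|]. unfold Rsqr. field; repeat split; nra.
Qed.

Lemma is_derive_log_gap (p v : R) : 0 < v < 1 ->
  is_derive (log_gap p) v (power_mean_slope p v - (v - atan v) / v ^ 2).
Proof.
intros Hv; apply (is_derive_minus (log_power_mean p) log_sandor_yang).
- now apply is_derive_log_power_mean.
- now apply is_derive_log_sandor_yang.
Qed.

(** Put [x = 1 + v], [y = 1 - v]. After cross-multiplication and cancellation
    the inequality reads
    [(x + y) x^(q-1) y^(p-1) <= (x + y) x^(p-1) y^(q-1)], that is
    [y^(p-q) <= x^(p-q)], which holds since [y < x]. *)
Lemma power_mean_slope_le (p q v : R) : q <= p -> 0 < v < 1 ->
  power_mean_slope q v <= power_mean_slope p v.
Proof.
intros Hqp Hv; unfold power_mean_slope.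
rewrite !(Rpower_step _ p), !(Rpower_step _ q) by lra.
replace (p - 1) with ((q - 1) + (p - q)) by ring.
rewrite !Rpower_plus.
assert (HW : Rpower (1 - v) (p - q) <= Rpower (1 + v) (p - q))
  by (apply Rle_Rpower_l; lra).
generalize (Rpower_pos (1 + v) (q - 1)) (Rpower_pos (1 - v) (q - 1))
  (Rpower_pos (1 - v) (p - q)) HW; clear HW.
generalize (Rpower (1 + v) (q - 1)) (Rpower (1 - v) (q - 1))
  (Rpower (1 + v) (p - q)) (Rpower (1 - v) (p - q)).
intros X Y U W HX HY HW HWU.
(* Now x^(q-1) = X, y^(q-1) = Y, x^(p-q) = U, y^(p-q) = W. *)
assert (HXU : 0 < X * U) by nra.
assert (HYW : 0 < Y * W) by nra.
assert (HD1 : 0 < (1 + v) * X + (1 - v) * Y) by nra.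
assert (HD2 : 0 < (1 + v) * (X * U) + (1 - v) * (Y * W)) by nra.
apply Rminus_le_0.
replace (_ - _) with (2 * (X * Y * (U - W))
  / (((1 + v) * X + (1 - v) * Y) * ((1 + v) * (X * U) + (1 - v) * (Y * W))))
  by (field; lra).
apply Rdiv_le_0_compat; [|now apply Rmult_lt_0_compat].
apply Rmult_le_pos; [lra|]; apply Rmult_le_pos; nra.
Qed.

(** * Monotonicity of the gap for p >= 4/3 *)

(** The two sides agree at [t = 1]. The left side minus the right side has a
    rational derivative whose numerator is [(1 - t)^4] times a polynomial with
    positive coefficients, so it is increasing, hence negative before [1]. *)
Lemma atan_rational_bound (t : R) : 0 < t < 1 ->
  (1 + t) * (1 - t ^ 3) / (2 * (1 + t ^ 4)) < atan ((1 - t ^ 3) / (1 + t ^ 3)).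
Proof.
intros Ht.
set (h := fun t => (1 + t) * (1 - t ^ 3) / (2 * (1 + t ^ 4))
  - atan ((1 - t ^ 3) / (1 + t ^ 3))).
set (R8 := fun t => 1 + 4 * t + 13 * t ^ 2 + 24 * t ^ 3 + 30 * t ^ 4
  + 24 * t ^ 5 + 13 * t ^ 6 + 4 * t ^ 7 + t ^ 8).
set (dh := fun t => (1 - t) ^ 4 * R8 t / (2 * (1 + t ^ 4) ^ 2 * (1 + t ^ 6))).
assert (Hd : forall x, 0 < x -> is_derive h x (dh x)).
{ intros x Hx; unfold h, dh, R8.
  assert (H3 := pow_lt x 3 Hx); assert (H4 := pow_lt x 4 Hx).
  assert (H6 := pow_lt x 6 Hx).
  auto_derive; [repeat split; simpl in *; lra|].
  unfold Rsqr; field; repeat split; lra. }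
assert (Hincr : forall x y, 0 < x -> x < y -> y < 1 -> h x < h y).
{ apply (increasing_of_derive_pos h dh).
  - intros z Hz; now apply Hd.
  - intros z [Hz0 Hz1]; unfold dh, R8.
    assert (H4 : 0 < (1 - z) ^ 4) by (apply pow_lt; lra).
    assert (Hp : forall n, 0 < z ^ n) by (intros n; now apply pow_lt).
    generalize (Hp 2%nat) (Hp 3%nat) (Hp 4%nat) (Hp 5%nat) (Hp 6%nat)
      (Hp 7%nat) (Hp 8%nat); intros.
    apply Rdiv_lt_0_compat; apply Rmult_lt_0_compat; lra. }
assert (Hlim : filterlim h (at_left 1) (locally (h 1))).
{ apply (filterlim_within_of_ex_derive _ h); exists (dh 1); apply Hd; lra. }
assert (Hh := lt_left_limit_of_increasing h 0 1 (h 1) Hincr Hlim t Ht).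
replace (h 1) with 0 in Hh; [unfold h in Hh; lra|].
unfold h; replace ((1 - 1 ^ 3) / (1 + 1 ^ 3)) with 0 by field.
rewrite atan_0; field.
Qed.

(** With [s = (1 + v)^(1/3)], [r = (1 - v)^(1/3)] and [t = r / s] one has
    [v = (1 - t^3) / (1 + t^3)] and
    [v - v^2 G(v) = (1 + t) (1 - t^3) / (2 (1 + t^4))], where [G] is the slope
    at [p = 4/3]; the inequality is then [atan_rational_bound]. *)
Lemma power_mean_slope_4_3_gt (v : R) : 0 < v < 1 ->
  (v - atan v) / v ^ 2 < power_mean_slope (4 / 3) v.
Proof.
intros Hv; unfold power_mean_slope.
replace (4 / 3 - 1) with (/ 3) by field.
set (s := Rpower (1 + v) (/ 3)); set (r := Rpower (1 - v) (/ 3)).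
assert (Hs : 0 < s) by apply Rpower_pos.
assert (Hr : 0 < r) by apply Rpower_pos.
assert (Hcube : forall x, 0 < x -> Rpower x (/ 3) ^ 3 = x).
{ intros x Hx; rewrite <- Rpower_pow by apply Rpower_pos.
  rewrite Rpower_mult.
  replace (/ 3 * INR 3) with 1 by (simpl; field); now apply Rpower_1. }
assert (Hs3 : s ^ 3 = 1 + v) by (apply Hcube; lra).
assert (Hr3 : r ^ 3 = 1 - v) by (apply Hcube; lra).
assert (Hrs : r < s) by (apply Rlt_Rpower_l; lra).
rewrite !(Rpower_step _ (4 / 3)) by lra.
replace (4 / 3 - 1) with (/ 3) by field; fold s r.
assert (Ht : 0 < r / s < 1).
{ split; [now apply Rdiv_lt_0_compat|].
  apply Rmult_lt_reg_r with s; [easy|].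
  unfold Rdiv; rewrite Rmult_assoc, Rinv_l; lra. }
assert (H := atan_rational_bound (r / s) Ht).
assert (Hv' : (1 - (r / s) ^ 3) / (1 + (r / s) ^ 3) = v).
{ replace ((r / s) ^ 3) with (r ^ 3 / s ^ 3) by (field; lra).
  rewrite Hr3, Hs3; field; lra. }
rewrite Hv' in H.
assert (Hden : 0 < (1 + v) * s + (1 - v) * r) by nra.
replace ((1 + r / s) * (1 - (r / s) ^ 3) / (2 * (1 + (r / s) ^ 4)))
  with (v * (s + r) / ((1 + v) * s + (1 - v) * r)) in H.
(* Since s^4 + r^4 = (1 + v) s + (1 - v) r, both
   v^2 (s - r) / (s^4 + r^4) and v - v (s + r) / (s^4 + r^4) have the numerator
   v ((1 + v) s + (1 - v) r - (s + r)) = v^2 (s - r). *)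
- apply Rmult_lt_reg_r with (v ^ 2); [nra|].
  unfold Rdiv at 1; rewrite Rmult_assoc, Rinv_l by nra.
  replace ((s - r) / ((1 + v) * s + (1 - v) * r) * v ^ 2)
    with (v - v * (s + r) / ((1 + v) * s + (1 - v) * r)) by (field; lra).
  lra.
- replace (1 - (r / s) ^ 3) with (2 * v / s ^ 3).
  + replace ((r / s) ^ 4) with ((r * r ^ 3) / (s * s ^ 3)) by (field; lra).
    rewrite Hr3, Hs3; field; repeat split; nra.
  + replace ((r / s) ^ 3) with (r ^ 3 / s ^ 3) by (field; lra).
    rewrite Hr3, Hs3; field; lra.
Qed.

Lemma log_gap_increasing (p : R) : 4 / 3 <= p ->
  forall x y, 0 < x -> x < y -> y < 1 -> log_gap p x < log_gap p y.
Proof.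
intros Hp; apply (increasing_of_derive_pos (log_gap p)
  (fun v => power_mean_slope p v - (v - atan v) / v ^ 2)).
- exact (is_derive_log_gap p).
- intros v Hv; generalize (power_mean_slope_le p (4 / 3) v Hp Hv)
    (power_mean_slope_4_3_gt v Hv); lra.
Qed.

(** * Limits of the gap at both ends *)

Lemma filterlim_atan_ratio_0 :
  filterlim (fun v => atan v / v) (at_right 0) (locally 1).
Proof.
apply filterlim_locally; intros eps.
assert (Hd : derivable_pt_lim atan 0 1).
{ replace 1 with (/ (1 + 0 ^ 2)) by field; apply derivable_pt_lim_atan. }
destruct (Hd eps (cond_pos eps)) as [delta Hdelta].
exists delta; intros v Hv Hv0.
replace (ball 1 eps (atan v / v)) with (Rabs (atan v / v - 1) < eps)
  by reflexivity.
replace (atan v / v) with ((atan (0 + v) - atan 0) / v)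
  by (rewrite atan_0, Rplus_0_l; field; lra).
apply Hdelta; [lra|].
replace v with (minus v 0) by (unfold minus, plus, opp; simpl; ring); exact Hv.
Qed.

Lemma filterlim_log_gap_0 (p : R) :
  filterlim (log_gap p) (at_right 0) (locally 0).
Proof.
apply filterlim_ext with (fun v =>
  log_power_mean p v - (/ 2 * ln (1 + v ^ 2) - 1) - atan v / v).
{ intros v; unfold log_gap, log_sandor_yang; ring. }
replace (locally 0) with (locally (1 - 1)) by (f_equal; ring).
apply filterlim_Rminus; [apply within_filter, locally_filter| |].
- set (f := fun v => log_power_mean p v - (/ 2 * ln (1 + v ^ 2) - 1)).
  assert (Hf0 : f 0 = 1).
  { unfold f, log_power_mean.
    replace (1 + 0 ^ 2) with 1 by ring.
    rewrite Rplus_0_r, Rminus_0_r, ln_1; destruct (Req_EM_T p 0); [ring|].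
    unfold Rpower; rewrite ln_1, Rmult_0_r, exp_0.
    replace ((1 + 1) / 2) with 1 by field; rewrite ln_1; ring. }
  rewrite <- Hf0.
  apply (filterlim_within_of_ex_derive _ f).
  unfold f, log_power_mean, Rpower; destruct (Req_EM_T p 0).
  + auto_derive; repeat split; lra.
  + auto_derive; repeat split; try lra.
    generalize (exp_pos (p * ln (1 + 0))) (exp_pos (p * ln (1 + - 0))); lra.
- exact filterlim_atan_ratio_0.
Qed.

(** Only [(1 - v)^p] is singular at [v = 1], where it tends to [0] because
    [0 < p]. In the limit, [M_p] is [2^(1 - 1/p)] and [B] is
    [sqrt 2 * exp (PI / 4 - 1)]; their quotient [B / M_p] is [lambda p]. *)
Lemma filterlim_log_gap_1 (p : R) : 0 < p ->
  filterlim (log_gap p) (at_left 1) (locally (- ln (lambda p))).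
Proof.
intros Hp.
apply filterlim_ext with (fun v =>
  1 / p * ln ((Rpower (1 + v) p + Rpower (1 - v) p) / 2) - log_sandor_yang v).
{ intros v; unfold log_gap, log_power_mean.
  destruct (Req_EM_T p 0); [lra|reflexivity]. }
replace (- ln (lambda p))
  with (1 / p * ln ((Rpower 2 p + 0) / 2) - log_sandor_yang 1).
2:{ unfold lambda, log_sandor_yang.
    rewrite ln_mult by (apply exp_pos || apply Rpower_pos).
    rewrite ln_exp, Rplus_0_r, atan_1; unfold Rdiv at 2.
    rewrite ln_mult, ln_Rinv by (try apply Rpower_pos; lra).
    unfold Rpower; rewrite !ln_exp.
    replace (1 + 1 ^ 2) with 2 by ring; field; lra. }
apply filterlim_Rminus; [apply within_filter, locally_filter| |].
(* [Rpower 0 p] is a junk value, so this term is treated by a limit and not by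
   continuity at v = 1. *)
- apply (filterlim_comp _ _ _ (fun v => Rpower (1 + v) p + Rpower (1 - v) p)
    (fun x => 1 / p * ln (x / 2)) _ (locally (Rpower 2 p + 0))).
  + apply (filterlim_comp_2 (G := locally (Rpower 2 p)) (H := locally 0)
      _ _ (fun x y : R => plus x y)).
    * replace 2 with (1 + 1) by ring.
      apply (filterlim_within_of_ex_derive _ (fun v => Rpower (1 + v) p)).
      unfold Rpower; auto_derive; lra.
    * apply (filterlim_comp _ _ _ (fun v => 1 - v) (fun x => Rpower x p)
        _ (at_right 0)); [|now apply filterlim_Rpower_0].
      intros P [d Hd]; exists d; intros v Hv Hv1.
      apply Hd; [|lra].
      apply Rabs_lt_between in Hv; simpl in Hv.
      unfold minus, plus, opp in Hv; simpl in Hv.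
      apply Rabs_lt_between; unfold minus, plus, opp; simpl; lra.
    * apply (filterlim_plus (Rpower 2 p) 0).
  + apply (ex_derive_continuous (fun x => 1 / p * ln (x / 2))).
    generalize (Rpower_pos 2 p); intros; auto_derive; lra.
- apply (filterlim_within_of_ex_derive _ log_sandor_yang).
  eexists; apply is_derive_log_sandor_yang, Rlt_0_1.
Qed.

(** * Failure of the upper bound for p < 4/3 *)

Lemma atan_lt_quintic (v : R) : 0 < v -> atan v < v - v ^ 3 / 3 + v ^ 5 / 5.
Proof.
intros Hv.
set (f := fun x => x - x ^ 3 / 3 + x ^ 5 / 5 - atan x).
assert (Hd : forall x, is_derive f x (x ^ 6 / (1 + x ^ 2))).
{ intros x; unfold f; assert (H := pow2_ge_0 x).
  auto_derive; [easy|]; unfold Rsqr; field; nra. }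
assert (Hlim : filterlim f (at_right 0) (locally (f 0))).
{ apply (filterlim_within_of_ex_derive _ f); eexists; apply Hd. }
assert (Hincr : forall x y, 0 < x -> x < y -> y < v + 1 -> f x < f y).
{ apply (increasing_of_derive_pos f (fun x => x ^ 6 / (1 + x ^ 2))).
  - intros z _; apply Hd.
  - intros z [Hz _]; apply Rdiv_lt_0_compat; [now apply (pow_lt z 6)|nra]. }
assert (H : f 0 < f v)
  by (apply (right_limit_lt_of_increasing f 0 (v + 1)); auto; lra).
unfold f in H at 1; rewrite atan_0 in H; unfold f in H; lra.
Qed.

(** The slope vanishes at [0] and has derivative [p - 1] there, for every
    exponent. *)
Lemma power_mean_slope_small (p c : R) : p - 1 < c ->
  exists delta, 0 < delta /\
    forall v, 0 < v < delta -> power_mean_slope p v < c * v.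
Proof.
intros Hc.
assert (Hd : derivable_pt_lim (power_mean_slope p) 0 (p - 1)).
{ apply is_derive_Reals; unfold power_mean_slope, Rpower.
  auto_derive.
  - generalize (exp_pos (p * ln (1 + 0))) (exp_pos (p * ln (1 + - 0))).
    intros; repeat split; lra.
  - replace (1 + 0) with 1 by ring; replace (1 + - 0) with 1 by ring.
    rewrite ln_1, !Rmult_0_r, exp_0; field. }
destruct (Hd (c - (p - 1))) as [delta Hdelta]; [lra|].
exists delta; split; [apply cond_pos|]; intros v Hv.
assert (H0 : power_mean_slope p 0 = 0).
{ unfold power_mean_slope; rewrite Rplus_0_r, Rminus_0_r; unfold Rdiv; ring. }
specialize (Hdelta v); rewrite Rplus_0_l, H0, Rminus_0_r in Hdelta.
assert (H := Hdelta ltac:(lra) ltac:(rewrite Rabs_pos_eq; lra)).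
apply Rabs_def2 in H; destruct H as [H _].
apply Rmult_lt_reg_r with (/ v); [apply Rinv_0_lt_compat; lra|].
rewrite Rmult_assoc, Rinv_r by lra; unfold Rdiv in H; lra.
Qed.

(** With [e = 4/3 - p], the slope is below [(1/3 - e/2) v] near [0], whereas
    [(v - atan v) / v^2] is at least [v/3 - v^3/5]. The gap therefore decreases
    as soon as [v^2/5 < e/2], for which [v < min 1 e] is enough. *)
Lemma log_gap_negative_near_0 (p : R) : p < 4 / 3 ->
  exists v, 0 < v < 1 /\ log_gap p v < 0.
Proof.
intros Hp; set (e := 4 / 3 - p).
destruct (power_mean_slope_small p (1 / 3 - e / 2)) as (d & Hd & Hslope);
  [unfold e; lra|].
set (m := Rmin d (Rmin 1 e)).
assert (Hm : 0 < m) by (unfold m, e; repeat apply Rmin_glb_lt; lra).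
assert (Hmd : m <= d) by apply Rmin_l.
assert (Hm1 : m <= 1) by (eapply Rle_trans; [apply Rmin_r|apply Rmin_l]).
assert (Hme : m <= e) by (eapply Rle_trans; [apply Rmin_r|apply Rmin_r]).
exists (m / 2); split; [lra|].
cut (- 0 < - log_gap p (m / 2)); [lra|].
apply (right_limit_lt_of_increasing (fun v => - log_gap p v) 0 m); [| |lra].
- apply (increasing_of_derive_pos (fun v => - log_gap p v)
    (fun v => - (power_mean_slope p v - (v - atan v) / v ^ 2))).
  + intros v Hv; apply (is_derive_opp (log_gap p)), is_derive_log_gap; lra.
  + intros v [Hv0 Hv1].
    assert (H1 := Hslope v ltac:(lra)); assert (H2 := atan_lt_quintic v Hv0).
    assert (H3 : v / 3 - v ^ 3 / 5 < (v - atan v) / v ^ 2).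
    { apply Rmult_lt_reg_r with (v ^ 2); [nra|].
      unfold Rdiv at 3; rewrite Rmult_assoc, Rinv_l by nra.
      replace ((v / 3 - v ^ 3 / 5) * v ^ 2) with (v ^ 3 / 3 - v ^ 5 / 5)
        by field; lra. }
    assert (H4 : v ^ 3 <= v * e) by nra.
    assert (H5 : 0 < v * e) by nra.
    lra.
- apply (filterlim_comp _ _ _ (log_gap p) Ropp _ (locally 0));
    [apply filterlim_log_gap_0|apply (filterlim_opp 0)].
Qed.

(** * Sharp bounds for the Sandor-Yang mean *)

Theorem theorem3p1 (p : R) :
  ((forall a b : R, 0 < a -> 0 < b -> a <> b ->
      sandor_yang_mean a b < power_mean p a b) <-> p >= 4 / 3)
  /\
  (p >= 4 / 3 ->
     (forall a b : R, 0 < a -> 0 < b -> a <> b ->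
        sandor_yang_mean a b > lambda p * power_mean p a b)
     /\
     (forall mu : R, mu > lambda p ->
        ~ (forall a b : R, 0 < a -> 0 < b -> a <> b ->
             sandor_yang_mean a b > mu * power_mean p a b))).
Proof.
assert (Hl : 0 < lambda p)
  by (apply Rmult_lt_0_compat; [apply exp_pos|apply Rpower_pos]).
split; [split|].
- intros H; apply Rnot_lt_ge; intros Hp.
  destruct (log_gap_negative_near_0 p Hp) as (v & Hv & Hneg).
  rewrite upper_bound_iff_log_gap in H; specialize (H v Hv); lra.
- intros Hp; apply upper_bound_iff_log_gap.
  apply right_limit_lt_of_increasing; [|apply filterlim_log_gap_0].
  apply log_gap_increasing; lra.
- intros Hp; split.
  + apply (lower_bound_iff_log_gap p (lambda p) Hl).
    apply lt_left_limit_of_increasing; [|apply filterlim_log_gap_1; lra].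
    apply log_gap_increasing; lra.
  + intros mu Hmu H.
    assert (Hgap := proj1 (lower_bound_iff_log_gap p mu ltac:(lra)) H).
    assert (Hln : ln (lambda p) < ln mu) by (apply ln_increasing; lra).
    (* A constant mu would bound the gap by - ln mu, hence also its limit at 1,
       which is - ln (lambda p). *)
    assert (Hle : Rbar_le (- ln (lambda p)) (- ln mu)).
    { apply (filterlim_le (F := at_left 1) (log_gap p) (fun _ => - ln mu)).
      - apply (filter_imp (fun v => 0 < v < 1)).
        + intros v Hv; now apply Rlt_le, Hgap.
        + apply eventually_at_left, Rlt_0_1.
      - apply filterlim_log_gap_1; lra.
      - apply filterlim_const. }
    simpl in Hle; lra.
Qed.
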